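(* Let $X$ be a complex Banach space, let $A,B\in B(X)$, and suppose that $A^kB^kA^k=A^{k+1}$ for some positive integer $k$. Then $A$ is generalized Drazin-meromorphic invertible if and only if $B^kA^k$ is generalized Drazin-meromorphic invertible.
   Context: $B(X)$ is the Banach algebra of bounded linear operators on $X$. The ascent $p(T)$ (descent $q(T)$) of $T\in B(X)$ is the smallest integer $n\ge 0$ with $\ker T^n=\ker T^{n+1}$ (respectively $R(T^n)=R(T^{n+1})$, $R$ denoting range), or $\infty$ if there is none. $T$ is Drazin invertible if $p(T)=q(T)<\infty$. $T$ is meromorphic if $\lambda I-T$ is Drazin invertible for all $\lambda\in\mathbb{C}\setminus\{0\}$. $T$ is generalized Drazin-meromorphic invertible if there exists $S\in B(X)$ such that $TS=ST$, $STS=S$ and $TST-T$ is meromorphic. *)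

(* Defs.v *)
From HB Require Import structures.
From mathcomp Require Import all_boot all_order all_algebra.
From mathcomp Require Import complex.
From mathcomp Require Import all_classical all_reals all_analysis.

Set Implicit Arguments.
Unset Strict Implicit.
Unset Printing Implicit Defensive.

Import Order.TTheory GRing.Theory Num.Theory.
Import numFieldNormedType.Exports.

Local Open Scope classical_set_scope.
Local Open Scope ring_scope.

Section BoundedOperators.
Variables (K : numFieldType) (X : normedModType K).

(* Norms take their values in K; an order relation with a norm forces
   M * `|x| to be real and nonnegative, even when K is R[i]. *)
Definition bounded_operator : pred (X -> X) :=
  [pred f | `[< linear f /\ exists M : K, forall x, `|f x| <= M * `|x| >]].

Record bop := BOp { bop_fun :> X -> X; _ : bounded_operator bop_fun }.

HB.instance Definition _ := [isSub for bop_fun].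
HB.instance Definition _ := [Choice of bop by <:].

Lemma bop_linear (T : bop) : linear T.
Proof. by case: T => f /= /asboolP[]. Qed.

Lemma bop_bounded (T : bop) : exists M : K, forall x, `|T x| <= M * `|x|.
Proof. by case: T => f /= /asboolP[]. Qed.

HB.instance Definition _ (T : bop) :=
  GRing.isLinear.Build K X X *:%R T (bop_linear T).

Lemma bounded_operator_submod_closed : submod_closed bounded_operator.
Proof.
split.
  apply/asboolP; split; last by exists 0 => x; rewrite normr0 mul0r.
  by move=> a x y; rewrite /= scaler0 addr0.
move=> a f g /asboolP[lf [M fM]] /asboolP[lg [N gN]]; apply/asboolP; split.
  move=> b x y; rewrite !fctE lf lg !scalerDr !scalerA [b * a]mulrC.
  by rewrite addrACA.
exists (`|a| * M + N) => x; rewrite !fctE mulrDl -mulrA.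
by rewrite (le_trans (ler_normD _ _))// lerD// normrZ ler_wpM2l.
Qed.

HB.instance Definition _ :=
  GRing.SubChoice_isSubLmodule.Build K (X -> X) bounded_operator bop
    bounded_operator_submod_closed.

Lemma bounded_operator_id : bounded_operator idfun.
Proof. by apply/asboolP; split=> //; exists 1 => x; rewrite mul1r. Qed.

Lemma bounded_operator_comp (S T : bop) : bounded_operator (S \o T).
Proof.
apply/asboolP; split; first by move=> a x y; rewrite /= !linearP.
have [M SM] := bop_bounded S; have [N TN] := bop_bounded T.
exists (`|M| * N) => x; rewrite /= -mulrA.
rewrite (@le_trans _ _ (`|M| * `|T x|))//; last by rewrite ler_wpM2l.
have M0 : 0 <= M * `|T x| by apply: le_trans (SM (T x)).
by rewrite (le_trans (SM _))// -[leLHS]ger0_norm// normrM normr_id.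
Qed.

Definition bop_one : bop := BOp bounded_operator_id.
Definition bop_mul (S T : bop) : bop := BOp (bounded_operator_comp S T).

Lemma bop_mulA : associative bop_mul.
Proof. by move=> S T U; apply: val_inj. Qed.

Lemma bop_mul1 : left_id bop_one bop_mul.
Proof. by move=> T; apply: val_inj. Qed.

Lemma bop_mulr1 : right_id bop_one bop_mul.
Proof. by move=> T; apply: val_inj. Qed.

Lemma bop_mulDl : left_distributive bop_mul +%R.
Proof. by move=> S T U; apply: val_inj. Qed.

Lemma bop_mulDr : right_distributive bop_mul +%R.
Proof. by move=> S T U; apply/val_inj/funext => x; rewrite /= linearD. Qed.

(* Only a possibly trivial ring: bop is the zero ring when X = 0. *)
HB.instance Definition _ := GRing.Zmodule_isPzRing.Build bop
  bop_mulA bop_mul1 bop_mulr1 bop_mulDl bop_mulDr.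

End BoundedOperators.

Arguments bounded_operator {K X} _.

(* None stands for infinity. *)
Definition least_index (P : nat -> Prop) : option nat :=
  if pselect (exists n, `[< P n >]) is left exP then Some (ex_minn exP)
  else None.

Section DrazinMeromorphic.
Variables (K : numFieldType) (X : normedModType K).
Implicit Types S T : bop X.

Definition op_ker T : set X := [set x | T x = 0].

Definition ascent T : option nat :=
  least_index (fun n => op_ker (T ^+ n) = op_ker (T ^+ n.+1)).

Definition descent T : option nat :=
  least_index (fun n => range (T ^+ n) = range (T ^+ n.+1)).

Definition drazin_invertible T : Prop :=
  ascent T = descent T /\ ascent T <> None.

Definition meromorphic T : Prop :=
  forall lambda : K, lambda != 0 -> drazin_invertible (lambda *: (1 : bop X) - T).

Definition gen_drazin_meromorphic_invertible T : Prop :=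
  exists S, [/\ T * S = S * T, S * T * S = S & meromorphic (T * S * T - T)].

End DrazinMeromorphic.

(* Main.v *)
(** Write [P = A^k], [Q = B^k] and [T = QP].  Then [PT = PA = AP] and
    [TA = T^2], so [P] and [T] intertwine [lambda - A] and [lambda - T], while
    [PT = A^(k+1)] and [TP = T^(k+1)] are invertible modulo [lambda - A] and
    [lambda - T] when [lambda <> 0].  Hence the kernel and range chains of
    [lambda - A] and [lambda - T] stop at the same places, and [A] is
    meromorphic iff [T] is.  If [S] is a generalized inverse of [A], take
    [Q S^2 P] for [T]; if [S] is one of [T], take [P S^(k+1)] for [A].  In both
    cases compressing [A] by the complementary idempotent preserves the
    relation between [A] and [Q], which reduces the theorem to the meromorphic
    case. *)
Require Import Defs.
From mathcomp Require Import all_boot all_order all_algebra.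
From mathcomp Require Import complex.
From mathcomp Require Import all_classical all_reals all_analysis.

Import Order.TTheory GRing.Theory Num.Theory.
Import numFieldNormedType.Exports.

Set Implicit Arguments.
Unset Strict Implicit.
Unset Printing Implicit Defensive.

Local Open Scope ring_scope.

(** * The relation [A^k Q A^k = A^(k+1)] and outer inverses in an arbitrary ring *)

Section RingIdentities.
Variable R : pzRingType.
Implicit Types A Q S L M U V E P T : R.

Lemma intertwineX L U V n : L * V = U * L -> L * V ^+ n = U ^+ n * L.
Proof.
move=> LV; elim: n => [|n IHn]; first by rewrite !expr0 mulr1 mul1r.
by rewrite exprSr mulrA IHn -mulrA LV mulrA -exprSr.
Qed.

(** Once a factor [A] next to [S] has become [V], commuting [V] past [S] brings the next [A] next to
    [S]. *)
Lemma mulX_eq_mulX S A V n :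
  S * A = S * V -> S * V = V * S -> S * A ^+ n = S * V ^+ n.
Proof.
move=> SA SV; elim: n => [|n IHn]; first by rewrite !expr0.
rewrite exprSr mulrA IHn exprSr.
have SVn : S * V ^+ n = V ^+ n * S by apply: intertwineX.
by rewrite SVn -mulrA SA mulrA -SVn mulrA.
Qed.

Section PowerRelation.
Variables (A Q : R) (k : nat).
Hypothesis AQA : A ^+ k * Q * A ^+ k = A ^+ k.+1.
Local Notation P := (A ^+ k).
Local Notation T := (Q * A ^+ k).

Lemma power_mul : P * T = P * A.
Proof. by rewrite mulrA AQA exprSr. Qed.

Lemma mul_base : T * A = T * T.
Proof. by rewrite -mulrA -exprSr -AQA !mulrA. Qed.

Lemma mul_power : T * P = T ^+ k.+1.
Proof. by rewrite (mulX_eq_mulX (V := T)) ?mul_base// -exprS. Qed.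

End PowerRelation.

Lemma idemX E n : E * E = E -> (0 < n)%N -> E ^+ n = E.
Proof.
by move=> EE; case: n => // n _; elim: n => // n IHn; rewrite exprS IHn.
Qed.

(** By [PQP = PA], [PQ] acts as [A] on multiples of [P], so [S'] follows Cline's formula for [QP]
    with [S] as inverse of [PQ]. Both [TS'] and [S'T] collapse to [QPS]. *)
Lemma outer_inverse_product A Q S P :
    P * Q * P = P * A -> A * P = P * A -> S * P = P * S -> A * S = S * A ->
    S * A * S = S ->
  let T := Q * P in let S' := Q * S ^+ 2 * P in
  [/\ T * S' = S' * T, S' * T * S' = S' & T * S' * T = T * (A * S)].
Proof.
move=> PQP AP SP AS SAS T S'.
have PQPr x : P * (Q * (P * x)) = P * (A * x) by rewrite !mulrA PQP.
have ASS : A * (S * S) = S by rewrite mulrA AS.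
have SSA : S * (S * A) = S by rewrite -AS mulrA.
have S'E : S' = Q * (P * (S * S)).
  by rewrite /S' expr2 -!mulrA SP [S * (P * S)]mulrA SP -mulrA.
have TS' : T * S' = Q * (P * S) by rewrite S'E /T -mulrA PQPr ASS.
have S'T : S' * T = Q * (P * S).
  have PQP' : P * (Q * P) = A * P by rewrite mulrA PQP -AP.
  by rewrite /S' /T expr2 -!mulrA PQP' (mulrA S A) (mulrA S (S * A)) SSA SP.
split; first by rewrite TS' S'T.
  rewrite -mulrA TS' /S' expr2 -!mulrA PQPr (mulrA P A) -AP.
  by rewrite -(mulrA A P) (mulrA S A) (mulrA S (S * A)) SSA (mulrA S P) SP
    -(mulrA P S) -S'E /S' expr2 -!mulrA SP.
by rewrite -mulrA S'T /T -!mulrA PQPr.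
Qed.

(** From [S = S(ST)] and [TA = TT] follows [SA = ST], so to the right of [S] powers of [A] turn into
    powers of [T], which cancel against [S]. The idempotent [AS'] is [A^k S^k]. *)
Lemma outer_inverse_base A T S k : (0 < k)%N ->
    A ^+ k * T = A ^+ k * A -> T * A = T * T -> T * S = S * T ->
    S * T * S = S ->
  let S' := A ^+ k * S ^+ k.+1 in
  [/\ A * S' = S' * A, S' * A * S' = S' & T * (A * S') = T * (T * S)].
Proof.
move=> k0 PT TA TS STS S'.
have STT : S * (S * T) = S by rewrite -TS mulrA.
have SA : S * A = S * T by rewrite -{1}STT -!mulrA TA (mulrA S T) (mulrA S (S * T)) STT.
have SkST : S ^+ k * (S * T) = S ^+ k.
  by case: k k0 {PT S'} => // k _; rewrite exprSr -mulrA STT.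
have AS' : A * S' = A ^+ k * S ^+ k.
  by rewrite /S' mulrA -exprS exprSr -PT -mulrA (commrX k.+1 TS) exprSr -mulrA
    SkST.
have S'A : S' * A = A ^+ k * S ^+ k.
  by rewrite /S' exprSr -!mulrA SA SkST.
have SkA : S ^+ k * A = S ^+ k * T.
  by case: k k0 {PT S' SkST AS' S'A} => // k _; rewrite exprSr -!mulrA SA.
have STk : S ^+ k * T ^+ k = S * T.
  by rewrite -exprMn_comm ?idemX//; rewrite mulrA STS.
have SkPSk : S ^+ k * (A ^+ k * S ^+ k) = S ^+ k.
  have TSk : T * S ^+ k = S ^+ k * T by apply: commrX.
  rewrite mulrA (mulX_eq_mulX k SkA)//.
  by rewrite STk -mulrA TSk mulrA -exprS exprSr -mulrA.
split; first by rewrite AS' S'A.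
  by rewrite -mulrA AS' /S' -mulrA exprS -mulrA SkPSk.
by rewrite AS' mulrA (mulX_eq_mulX k TA)// -mulrA -exprMn_comm ?idemX// -mulrA
  (mulrA S T S) STS.
Qed.

(** [E] commutes with [A], so it can be moved out of [A^k E Q A^k E] although it need not commute
    with [Q]. The minus sign in [A'] matches the form [TST - T]; the sign in [Q'] makes up for the
    odd difference between the exponents [2k] and [k+1] of [A']. *)
Lemma compress_power_relation A Q E k :
    (0 < k)%N -> A ^+ k * Q * A ^+ k = A ^+ k.+1 -> A * E = E * A -> E * E = E ->
  let A' := - (A * E) in let Q' := - ((-1) ^+ k * Q) in
  A' ^+ k * Q' * A' ^+ k = A' ^+ k.+1 /\ Q' * A' ^+ k = - (Q * A ^+ k * E).
Proof.
move=> k0 AQA AE EE A' Q'.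
have A'X n : (0 < n)%N -> A' ^+ n = (-1) ^+ n * (A ^+ n * E).
  by move=> n0; rewrite /A' exprNn exprMn_comm// (idemX EE).
have EAX n : E * A ^+ n = A ^+ n * E by apply/commrX/esym.
rewrite !A'X// /Q' (exprS (-1)) -[(-1) ^+ k]signr_odd.
case: (odd k); rewrite ?expr0 ?expr1 ?mulN1r ?opprK;
  rewrite ?mul1r ?(mulNr, mulrN, opprK, mul1r) !mulrA; split=> //;
  by rewrite -EAX -!mulrA (mulrA _ Q) (mulrA _ _ E) AQA mulrA EAX -mulrA EE.
Qed.

End RingIdentities.

Lemma eq_least_index (P P' : nat -> Prop) :
  (forall n, P n <-> P' n) -> least_index P = least_index P'.
Proof. by move=> PP'; congr least_index; apply/funext => n; apply/propext. Qed.

(** * Kernel and range chains of bounded operators *)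

Section Operators.
Variables (K : numFieldType) (X : normedModType K).
Implicit Types A Q S T L M H U V : bop X.
Local Open Scope classical_set_scope.

Lemma bop_scalar_comm (a : K) S : a *: (1 : bop X) * S = S * (a *: (1 : bop X)).
Proof. by apply/val_inj/funext => x; rewrite /= linearZ. Qed.

(** Inserting [LM + HU = 1] gives [U^n = L V^n M + H U^(n+1)]. The second term vanishes on the
    kernel of [U^(n+1)] and has values in the range of [U^(n+1)], so only the term in [V^n] has to
    be controlled. *)
Lemma stationary_transfer U V L M H n :
    L * V = U * L -> M * U = V * M -> H * U = U * H -> L * M + H * U = 1 ->
  (op_ker (V ^+ n) = op_ker (V ^+ n.+1) ->
     op_ker (U ^+ n) = op_ker (U ^+ n.+1)) /\
  (range (V ^+ n) = range (V ^+ n.+1) -> range (U ^+ n) = range (U ^+ n.+1)).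
Proof.
move=> LV MU HU LMHU.
have LVX m : L * V ^+ m = U ^+ m * L by apply: intertwineX.
have MUX m : M * U ^+ m = V ^+ m * M by apply: intertwineX.
have UXH m : H * U ^+ m = U ^+ m * H by apply: intertwineX.
have UnE : U ^+ n = L * V ^+ n * M + H * U ^+ n.+1.
  by rewrite LVX UXH exprSr -!mulrA -mulrDr -HU LMHU mulr1.
split=> [kerV|ranV]; apply/seteqP; split=> x.
- by rewrite /op_ker /= exprS => Ux; rewrite -[LHS]/(U ((U ^+ n) x)) Ux linear0.
- rewrite /op_ker /= => Ux.
  have : op_ker (V ^+ n) (M x).
    by rewrite kerV /op_ker /= -[LHS]/((V ^+ n.+1 * M) x) -MUX -[LHS]/(M _) Ux linear0.
  rewrite /op_ker /= => VMx.
  rewrite UnE -[LHS]/(L ((V ^+ n) (M x)) + H ((U ^+ n.+1) x)).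
  by rewrite VMx Ux !linear0 addr0.
- move=> [z _ <-].
  have : range (V ^+ n) ((V ^+ n) (M z)) by exists (M z).
  (* With [V^n M z = V^(n+1) w], the two terms of [U^n z] are [U^(n+1) L w] and [U^(n+1) H z]. *)
  rewrite ranV => -[w _ VwE]; exists (L w + H z) => //.
  rewrite linearD -[X in X + _]/((U ^+ n.+1 * L) w) -LVX.
  rewrite -[X in _ + X]/((U ^+ n.+1 * H) z) -UXH.
  by rewrite -[(L * _) w]/(L _) VwE [in RHS]UnE.
- by move=> [z _ <-]; exists (U z) => //; rewrite exprSr.
Qed.

(* [lambda ^ m - A ^ m] is a multiple of [lambda - A], so [L * M = A ^+ m]
   is invertible modulo [lambda - A]. *)
Lemma stationary_shift_transfer A T L M m (lambda : K) n : lambda != 0 ->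
    L * T = A * L -> M * A = T * M -> L * M = A ^+ m ->
  let U := lambda *: (1 : bop X) - A in let V := lambda *: (1 : bop X) - T in
  (op_ker (V ^+ n) = op_ker (V ^+ n.+1) ->
     op_ker (U ^+ n) = op_ker (U ^+ n.+1)) /\
  (range (V ^+ n) = range (V ^+ n.+1) -> range (U ^+ n) = range (U ^+ n.+1)).
Proof.
move=> lambda0 LT MA LM U V.
pose l := lambda *: (1 : bop X); pose l' := lambda^-1 *: (1 : bop X).
have l'l : l' * l = 1.
  apply/val_inj/funext => x.
  by rewrite -[LHS]/(lambda^-1 *: (lambda *: x)) scalerA mulVf// scale1r.
have l'X S : l' ^+ m * S = S * l' ^+ m.
  by apply/esym/commrX/esym; apply: bop_scalar_comm.
have l'lX : l' ^+ m * l ^+ m = 1.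
  by rewrite -exprMn_comm ?l'l ?expr1n//; apply: bop_scalar_comm.
have lA : GRing.comm l A by apply: bop_scalar_comm.
pose G := \sum_(i < m) l ^+ (m.-1 - i) * A ^+ i.
have UG : l ^+ m - A ^+ m = U * G by rewrite subrXX_comm.
have GU : G * U = U * G.
  apply/esym/commr_sum => i _.
  by apply/commrM; apply/commrX/commr_sym/commrB;
    rewrite ?commr_refl//; apply/commr_sym.
(* The factor [lambda^-m] normalizes [A^m + G U = lambda^m] to the identity. *)
apply: (@stationary_transfer U V (l' ^+ m * L) M (l' ^+ m * G)).
- rewrite mulrA -[U * _]l'X -!mulrA; congr (_ * _).
  by rewrite mulrBr mulrBl LT bop_scalar_comm.
- by rewrite mulrBr mulrBl MA bop_scalar_comm.
- by rewrite mulrA -[U * _]l'X -!mulrA GU.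
- by rewrite -!mulrA -mulrDr LM GU -UG addrC subrK.
Qed.

Lemma meromorphic_product A Q k : A ^+ k * Q * A ^+ k = A ^+ k.+1 ->
  meromorphic A <-> meromorphic (Q * A ^+ k).
Proof.
move=> AQA; set T := Q * A ^+ k.
have PT : A ^+ k * T = A * A ^+ k by rewrite power_mul// -exprSr exprS.
have TA : T * A = T * T by apply: mul_base.
have AT (lambda : K) : lambda != 0 ->
    drazin_invertible (lambda *: (1 : bop X) - A) <-> drazin_invertible (lambda *: (1 : bop X) - T).
  move=> lambda0; rewrite /drazin_invertible.
  (* The same two intertwiners serve both directions with their roles exchanged: [A^k T = A^(k+1)]
     and [T A^k = T^(k+1)]. *)
  pose UV n := @stationary_shift_transfer A T (A ^+ k) T k.+1 lambda n lambda0.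
  pose VU n := @stationary_shift_transfer T A T (A ^+ k) k.+1 lambda n lambda0.
  have -> : ascent (lambda *: (1 : bop X) - A) = ascent (lambda *: (1 : bop X) - T).
    apply: eq_least_index => n; split.
      by apply: (VU n _ _ _).1 => //; apply: mul_power.
    by apply: (UV n _ _ _).1 => //; rewrite PT -exprS.
  have -> // : descent (lambda *: (1 : bop X) - A) = descent (lambda *: (1 : bop X) - T).
  apply: eq_least_index => n; split.
    by apply: (VU n _ _ _).2 => //; apply: mul_power.
  by apply: (UV n _ _ _).2 => //; rewrite PT -exprS.
by split=> mer lambda lambda0; apply/(AT lambda lambda0)/mer.
Qed.

(** Both operators are negated compressions by [1 - E], and these compressions again satisfy the
    power relation. *)
Lemma meromorphic_compress A Q E k :
    (0 < k)%N -> A ^+ k * Q * A ^+ k = A ^+ k.+1 -> A * E = E * A -> E * E = E ->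
  meromorphic (A * E - A) <-> meromorphic (Q * A ^+ k * E - Q * A ^+ k).
Proof.
move=> k0 AQA AE EE.
have AF : A * (1 - E) = (1 - E) * A by rewrite mulrBl mulrBr mulr1 mul1r AE.
have FF : (1 - E) * (1 - E) = 1 - E.
  by rewrite mulrBl mul1r mulrBr mulr1 EE subrr subr0.
have [AQA' QA'] := compress_power_relation k0 AQA AF FF.
have -> : A * E - A = - (A * (1 - E)) by rewrite mulrBr mulr1 opprB.
have -> : Q * A ^+ k * E - Q * A ^+ k = - (Q * A ^+ k * (1 - E)).
  by rewrite mulrBr mulr1 opprB.
by rewrite -QA'; apply: meromorphic_product.
Qed.

End Operators.

Theorem theorem3p3 (R : realType) (X : completeNormedModType R[i])
    (A B : bop X) (k : nat) (hk : (0 < k)%N)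
    (hAB : A ^+ k * B ^+ k * A ^+ k = A ^+ k.+1) :
  gen_drazin_meromorphic_invertible A <->
  gen_drazin_meromorphic_invertible (B ^+ k * A ^+ k).
Proof.
have compress := @meromorphic_compress _ _ A (B ^+ k) _ k hk hAB.
split=> -[S [comm SS mer]].
  have SP : S * A ^+ k = A ^+ k * S by apply/commrX/esym.
  have PQP : A ^+ k * B ^+ k * A ^+ k = A ^+ k * A by rewrite hAB exprSr.
  have AP : A * A ^+ k = A ^+ k * A by rewrite -exprS exprSr.
  have [TS' S'TS' TS'T] := outer_inverse_product PQP AP SP comm SS.
  exists (B ^+ k * S ^+ 2 * A ^+ k); split=> //.
  (* Both remainders are compressions along the idempotent [E = AS]: [ASA = AE] and [TS'T = TE]. *)
  rewrite TS'T; apply/(compress (A * S)).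
  - by rewrite -mulrA -comm.
  - by rewrite -mulrA (mulrA S A S) SS.
  - by rewrite comm mulrA.
have PT := power_mul hAB; have TA := mul_base hAB.
have [] := outer_inverse_base hk PT TA comm SS.
set S' := A ^+ k * S ^+ k.+1 => AS' S'AS' TAS'.
exists S'; split=> //.
(* Here [E = AS'], and [TE = T(TS) = TST] identifies the remainder of [T]. *)
rewrite -mulrA -AS'; apply/(compress (A * S')).
- by rewrite -mulrA -AS'.
- by rewrite -mulrA (mulrA S' A S') S'AS'.
- by rewrite TAS' [X in _ * X - _]comm (mulrA _ S).
Qed.
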